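(* Let $R$ be a rotation of $\mathbb{R}^4$, with associated two-dimensional subspace $\Pi$ and orthogonal complement $\Pi^\perp$, and with rotation angles $\alpha$ in the plane $\Pi$ and $\beta$ in the plane $\Pi^\perp$. Pick $\mathbf{a},\mathbf{b}\in\Pi$ and $\mathbf{c},\mathbf{d}\in\Pi^\perp$ such that $\{\mathbf{a},\mathbf{b},\mathbf{c},\mathbf{d}\}$ is an orthonormal basis of $\mathbb{R}^4$. Then $$R\mathbf{a}=\cos\alpha\,\mathbf{a}+\sin\alpha\,\mathbf{b},\quad R\mathbf{b}=-\sin\alpha\,\mathbf{a}+\cos\alpha\,\mathbf{b},\quad R\mathbf{c}=\cos\beta\,\mathbf{c}+\sin\beta\,\mathbf{d},\quad R\mathbf{d}=-\sin\beta\,\mathbf{c}+\cos\beta\,\mathbf{d},$$ and hence the matrix of the rotation is $$R=\cos\alpha\,(\mathbf{a}\mathbf{a}^T+\mathbf{b}\mathbf{b}^T)+\sin\alpha\,(\mathbf{b}\mathbf{a}^T-\mathbf{a}\mathbf{b}^T)+\cos\beta\,(\mathbf{c}\mathbf{c}^T+\mathbf{d}\mathbf{d}^T)+\sin\beta\,(\mathbf{d}\mathbf{c}^T-\mathbf{c}\mathbf{d}^T).$$ Moreover, $R$ is an orthogonal matrix with determinant one.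
   Context: Vectors of $\mathbb{R}^4$ are column vectors, so $\mathbf{x}\mathbf{y}^T$ is a $4\times4$ matrix. A linear transformation $R$ of $\mathbb{R}^4$ is called a rotation if there exists a two-dimensional subspace $\Pi$ of $\mathbb{R}^4$ such that the angle between the vectors $R\mathbf{x}$ and $\mathbf{x}$ is a constant for all $\mathbf{x}\in\Pi$, and the angle between the vectors $R\mathbf{y}$ and $\mathbf{y}$ is a constant for all $\mathbf{y}\in\Pi^\perp$, where $\Pi^\perp$ is the orthogonal complement of $\Pi$.
   Formalization: A rotation is also required to map Π and Π^⊥ each into itself and preserve lengths there (otherwise 2I is a counterexample), and α, β are directed angles modulo 2π, measured from a towards b and from c towards d. *)

(* Defs.v *)
From HB Require Import structures.
From mathcomp Require Import all_boot all_order all_algebra.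
From mathcomp Require Import all_classical all_reals all_analysis.

Set Implicit Arguments.
Unset Strict Implicit.
Unset Printing Implicit Defensive.

Import Order.TTheory GRing.Theory Num.Theory.
Local Open Scope ring_scope.

Section EuclideanSpace.
Context {R : realType} {n : nat}.
Implicit Types (x y : 'cV[R]_n).

Definition dot x y : R := (x^T *m y) 0 0.

Let dotBl y : GRing.linear_for *%R (dot^~ y).
Proof. by move=> k u v; rewrite /dot linearP mulmxDl -scalemxAl !mxE. Qed.

Let dotBr x : GRing.linear_for *%R (dot x).
Proof. by move=> k u v; rewrite /dot linearP /= !mxE. Qed.

HB.instance Definition _ :=
  @bilinear_isBilinear.Build R 'cV[R]_n 'cV[R]_n R
    *%R *%R dot (dotBl, dotBr).

Let dotC x y : dot x y = (-1) ^+ false * idfun (dot y x).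
Proof.
rewrite expr0 mul1r /= /dot !mxE.
by apply: eq_bigr => i _; rewrite !mxE mulrC.
Qed.

HB.instance Definition _ :=
  @isHermitianSesquilinear.Build R 'cV[R]_n false idfun dot dotC.

(* The norm that the libraries put on matrices is the sup norm. *)
Definition enorm x : R := Num.sqrt (dot x x).

(* Undirected, in [0, pi]; meaningful only for nonzero vectors. *)
Definition angle x y : R := acos (dot x y / (enorm x * enorm y)).

(* Directed angle from x to y, in ]-pi, pi], for x, y in the plane with
   orthonormal basis (a, b), counted positively from a towards b. The tested
   quantity is the determinant of the coordinates of (x, y) in (a, b). *)
Definition dangle (a b x y : 'cV[R]_n) : R :=
  if 0 <= dot a x * dot b y - dot b x * dot a y then angle x y
  else - angle x y.

Definition orthocomp (V : {vspace 'cV[R]_n}) : {vspace 'cV[R]_n} :=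
  orthov (dot : {symmetric 'cV[R]_n}) V.

Definition orthonormal_basis (s : seq 'cV[R]_n) : Prop :=
  basis_of fullv s /\ orthonormal (dot : {symmetric 'cV[R]_n}) s.

(* The angle condition alone is satisfied by homotheties, and, with V not
   stable, by maps such as left multiplication by a unit quaternion. That T
   turns vectors of V within V, without changing their lengths, is therefore
   part of the definition. *)
Definition rotates (T : 'M[R]_n) (V : {vspace 'cV[R]_n}) : Prop :=
  [/\ forall x, x \in V -> T *m x \in V,
      forall x, x \in V -> enorm (T *m x) = enorm x &
      exists theta : R,
        forall x, x \in V -> x != 0 -> angle (T *m x) x = theta].

(* alpha, a real number taken modulo 2 pi, is the directed angle by which T
   turns the plane V oriented by its orthonormal basis (a, b). When T rotates
   V this angle is the same for all nonzero vectors of V, so that any one of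
   them determines it. *)
Definition rotation_angle (T : 'M[R]_n) (V : {vspace 'cV[R]_n})
    (a b : 'cV[R]_n) (alpha : R) : Prop :=
  exists x : 'cV[R]_n, [/\ x \in V, x != 0 &
    exists k : int, alpha = dangle a b x (T *m x) + k%:~R * (2 * pi)].

End EuclideanSpace.

(* T is a rotation of R^4 with associated plane P. *)
Definition is_rotation {R : realType} (T : 'M[R]_4)
    (P : {vspace 'cV[R]_4}) : Prop :=
  [/\ \dim P = 2%N, rotates T P & rotates T (orthocomp P)].

(* Main.v *)
(** On a plane that T preserves isometrically, T has an orthogonal 2x2 matrix in
    an orthonormal basis. Constancy of the undirected angle excludes reflections,
    so T x = p x + q Jx with J the quarter turn and p^2 + q^2 = 1; the undirected
    angle is then acos p and the orientation test in the directed angle has the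
    sign of q, hence p = cos alpha and q = sin alpha. With Q the orthogonal matrix
    with columns a, b, c, d, T = Q D Q^T for D block diagonal made of two plane
    rotation matrices. *)
Require Import Defs.
From mathcomp Require Import all_boot all_order all_algebra.
From mathcomp Require Import all_classical all_reals all_analysis.
From mathcomp Require Import ring lra.
Import Order.TTheory GRing.Theory Num.Theory.
Local Open Scope ring_scope.

Section Trigonometry.
Context {R : realType}.
Implicit Types p q t : R.

Lemma cosD2piz t (k : int) : cos (t + k%:~R * (2 * pi)) = cos t.
Proof.
have -> : k%:~R * (2 * pi) = (pi *+ 2) *~ k :> R.
  by rewrite mulrzl mulr_natl.
case: k => n; first exact/periodicn/cosD2pi.
(* [Negz n] is [- n.+1]: adding [n.+1] periods back to the argument cancels the shift. *)
by rewrite NegzE mulrNz -pmulrn -[LHS](periodicn (@cosD2pi R) n.+1) subrK.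
Qed.

Lemma sinD2piz t (k : int) : sin (t + k%:~R * (2 * pi)) = sin t.
Proof. by rewrite -!cosBpihalf addrAC cosD2piz. Qed.

Lemma sqrD1_itv {p q} : p ^+ 2 + q ^+ 2 = 1 -> -1 <= p <= 1.
Proof. by move=> pq1; apply/andP; split; nra. Qed.

(** The conditional has the shape of [dangle]. Both branches have cosine [p] because cosine is
    even. *)
Lemma cos_signed_acos p q : p ^+ 2 + q ^+ 2 = 1 ->
  cos (if 0 <= q then acos p else - acos p) = p.
Proof.
move=> /sqrD1_itv pI.
by case: ifP => _; rewrite ?cosN acosK // in_itv.
Qed.

(** On the unit circle [sin (acos p)] is the absolute value of [q]; the branch restores its sign. *)
Lemma sin_signed_acos p q : p ^+ 2 + q ^+ 2 = 1 ->
  sin (if 0 <= q then acos p else - acos p) = q.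
Proof.
move=> pq1; have pI := sqrD1_itv pq1.
have sE : sin (acos p) = `|q| by rewrite sin_acos // -pq1 addrC addKr sqrtr_sqr.
case: ifPn => q0; rewrite ?sinN sE; first exact: ger0_norm.
by rewrite ltr0_norm ?opprK // ltNge.
Qed.

Lemma acos_inj p q : -1 <= p <= 1 -> -1 <= q <= 1 -> acos p = acos q -> p = q.
Proof. by move=> pI qI e; rewrite -[p]acosK ?in_itv // e acosK ?in_itv. Qed.

End Trigonometry.

Section Euclidean.
Context {R : realType} {n : nat}.
Implicit Types (x y a b : 'cV[R]_n) (T : 'M[R]_n) (V : {vspace 'cV[R]_n}).

Lemma dotC x y : dot x y = dot y x.
Proof. by rewrite /dot -{1}[y]trmxK -trmx_mul mxE. Qed.

Lemma dotDl x y z : dot (x + y) z = dot x z + dot y z.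
Proof. exact: linearDl. Qed.

Lemma dotZl k x z : dot (k *: x) z = k * dot x z.
Proof. exact: linearZl_LR. Qed.

Lemma dotDr x y z : dot z (x + y) = dot z x + dot z y.
Proof. exact: linearDr. Qed.

Lemma dotZr k x z : dot z (k *: x) = k * dot z x.
Proof. exact: linearZr_LR. Qed.

Lemma dot_ge0 x : 0 <= dot x x.
Proof.
by rewrite /dot mxE sumr_ge0 // => i _; rewrite mxE -expr2 sqr_ge0.
Qed.

Lemma sqr_enorm x : enorm x ^+ 2 = dot x x.
Proof. exact/sqr_sqrtr/dot_ge0. Qed.

Lemma mul_col_dot x y z : x *m y^T *m z = dot y z *: x.
Proof. by rewrite -mulmxA [y^T *m z]mx11_scalar mul_mx_scalar. Qed.

Lemma rotates_angle T V x : rotates T V -> x \in V ->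
  angle (T *m x) x = acos (dot (T *m x) x / dot x x).
Proof. by case=> _ nT _ xV; rewrite /angle nT // -expr2 sqr_enorm. Qed.

(* Writing T a = p a + q b and T b = r a + s b, the isometry condition at a,
   b, a + b gives an orthogonal matrix, and equality of the angles at a, b,
   a + b gives s = p and r = - q, which excludes reflections. *)
Lemma rotates_plane T V a b :
    rotates T V -> a \in V -> b \in V ->
    dot a a = 1 -> dot b b = 1 -> dot a b = 0 ->
    (forall x, x \in V -> x = dot a x *: a + dot b x *: b) ->
  exists p q, [/\ p ^+ 2 + q ^+ 2 = 1, T *m a = p *: a + q *: b &
    T *m b = - q *: a + p *: b].
Proof.
move=> rT aV bV aa bb ab spV; have ba : dot b a = 0 by rewrite dotC.
have [stT nT [t angT]] := rT.
set p := dot a (T *m a); set q := dot b (T *m a).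
set r := dot a (T *m b); set s := dot b (T *m b).
have Ta : T *m a = p *: a + q *: b by apply/spV/stT.
have Tb : T *m b = r *: a + s *: b by apply/spV/stT.
have dotT x : x \in V -> dot (T *m x) (T *m x) = dot x x.
  by move=> xV; rewrite -!sqr_enorm nT.
pose dotE := (dotDl, dotDr, dotZl, dotZr, aa, bb, ab, ba).
have nz x : dot x x != 0 -> x != 0.
  by apply: contraNneq => ->; rewrite /dot mulmx0 mxE.
have dab : dot (a + b) (a + b) = 2 by rewrite !dotE; ring.
have abV : a + b \in V by rewrite memvD.
have tE x : x \in V -> dot x x != 0 -> t = acos (dot (T *m x) x / dot x x).
  by move=> xV x0; rewrite -(rotates_angle _ _ _ rT xV) angT ?nz.
have h1 : p ^+ 2 + q ^+ 2 = 1.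
  by have := dotT a aV; rewrite Ta !dotE => <-; ring.
have h2 : s ^+ 2 + r ^+ 2 = 1.
  by have := dotT b bV; rewrite Tb !dotE => <-; ring.
(* The isometry condition at [a + b] reads [(p + r)^2 + (q + s)^2 = 2]; [h1] and [h2] leave only the
   cross terms. *)
have h3 : p * r + q * s = 0.
  have := dotT _ abV; rewrite mulmxDr Ta Tb dab !dotE; nra.
have ta : t = acos p.
  by rewrite (tE a) ?aa ?oner_eq0 // Ta !dotE; congr acos; field.
have tb : t = acos s.
  by rewrite (tE b) ?bb ?oner_eq0 // Tb !dotE; congr acos; field.
have tab : t = acos ((p + q + r + s) / 2).
  rewrite (tE (a + b)) ?dab ?pnatr_eq0 // mulmxDr Ta Tb !dotE.
  by congr acos; field.
have ps : p = s.
  by apply: acos_inj (sqrD1_itv h1) (sqrD1_itv h2) _; rewrite -ta.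
have pm : p = (p + q + r + s) / 2.
  apply: acos_inj (sqrD1_itv h1) _ _; last by rewrite -ta.
  (* The two numbers are the coordinates of the unit vector [T (a + b) / sqrt 2] in the orthonormal
     basis [(a + b) / sqrt 2], [(a - b) / sqrt 2]. *)
  apply: (@sqrD1_itv _ _ ((p + r - q - s) / 2)).
  have -> : ((p + q + r + s) / 2) ^+ 2 + ((p + r - q - s) / 2) ^+ 2 =
      (p ^+ 2 + q ^+ 2 + (s ^+ 2 + r ^+ 2) + 2 * (p * r + q * s)) / 2 by field.
  by rewrite h1 h2 h3; field.
have rq : r = - q by lra.
by exists p, q; split=> //; rewrite Tb rq -ps.
Qed.

(** At any nonzero [x] of the plane, the inner product of [T x] with [x] is [p] times the squared
    norm of [x], and the orientation determinant is [q] times it. So [dangle] depends only on [p]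
    and [q]. *)
Lemma rotation_angle_plane T V a b alpha :
    rotates T V -> a \in V -> b \in V ->
    dot a a = 1 -> dot b b = 1 -> dot a b = 0 ->
    (forall x, x \in V -> x = dot a x *: a + dot b x *: b) ->
    rotation_angle T V a b alpha ->
  T *m a = cos alpha *: a + sin alpha *: b /\
  T *m b = - sin alpha *: a + cos alpha *: b.
Proof.
move=> rT aV bV aa bb ab spV [x [xV x0 [k ->]]].
have ba : dot b a = 0 by rewrite dotC.
have [p [q [pq1 Ta Tb]]] := rotates_plane _ _ _ _ rT aV bV aa bb ab spV.
rewrite cosD2piz sinD2piz.
suff -> : dangle a b x (T *m x) = if 0 <= q then acos p else - acos p.
  by rewrite cos_signed_acos // sin_signed_acos.
set u := dot a x; set v := dot b x; have xE : x = u *: a + v *: b by exact: spV.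
have angC : angle x (T *m x) = angle (T *m x) x.
  by rewrite /angle dotC [enorm x * _]mulrC.
pose dotE := (dotDl, dotDr, dotZl, dotZr, aa, bb, ab, ba).
have Tx : T *m x = (u * p - v * q) *: a + (u * q + v * p) *: b.
  rewrite xE mulmxDr -!scalemxAr Ta Tb !scalerDr !scalerA addrACA -!scalerDl.
  by rewrite mulrN.
have xx : dot x x = u ^+ 2 + v ^+ 2 by rewrite xE !dotE; ring.
have w0 : 0 < u ^+ 2 + v ^+ 2.
  rewrite lt0r addr_ge0 ?sqr_ge0 // andbT paddr_eq0 ?sqr_ge0 // !sqrf_eq0.
  apply: contra x0 => /andP[/eqP u0 /eqP v0].
  by rewrite xE u0 v0 !scale0r addr0.
have Txx : dot (T *m x) x = p * (u ^+ 2 + v ^+ 2).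
  by rewrite Tx xE !dotE; ring.
rewrite /dangle angC (rotates_angle _ _ _ rT xV) Txx xx mulfK ?gt_eqF // Tx.
rewrite -/u -/v !dotE.
(* This is the orientation determinant of [x] and [T x]; by [w0] it has the sign of [q]. *)
suff -> : u * ((u * p - v * q) * 0 + (u * q + v * p) * 1)
   - v * ((u * p - v * q) * 1 + (u * q + v * p) * 0) = q * (u ^+ 2 + v ^+ 2).
  by rewrite pmulr_lge0.
by ring.
Qed.

End Euclidean.

Section PlaneRotation.
Context {R : realType}.
Implicit Types t : R.

(** The size is kept as [1 + 1] to match the block [row_mx a b] of two columns. *)
Definition plane_rotation t : 'M[R]_(1 + 1) :=
  block_mx (cos t)%:M (- sin t)%:M (sin t)%:M (cos t)%:M.

Lemma plane_rotation_orthogonal t :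
  (plane_rotation t)^T *m plane_rotation t = 1%:M.
Proof.
rewrite /plane_rotation tr_block_mx !tr_scalar_mx mulmx_block.
rewrite -!scalar_mxM -!raddfD /=.
have cs := cos2Dsin2 t.
have -> : cos t * cos t + sin t * sin t = 1 by rewrite -cs; ring.
have -> : cos t * - sin t + sin t * cos t = 0 by ring.
have -> : - sin t * cos t + cos t * sin t = 0 by ring.
have -> : - sin t * - sin t + cos t * cos t = 1 by rewrite -cs; ring.
by rewrite raddf0 -scalar_mx_block.
Qed.

Lemma det_plane_rotation t : \det (plane_rotation t) = 1.
Proof.
rewrite (expand_det_row _ (lshift 1 0)) big_split_ord /= !big_ord1.
have minorE (i j : 'I_(1 + 1)) (A : 'M[R]_(1 + 1)) :
    row' i (col' j A) 0 0 = A (lift i 0) (lift j 0) by rewrite !mxE.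
rewrite /cofactor !det_mx11 !minorE.
have -> : @lift (1 + 1) (lshift 1 0) 0 = rshift 1 0 by apply: val_inj.
have -> : @lift (1 + 1) (rshift 1 0) 0 = lshift 1 0 by apply: val_inj.
rewrite /plane_rotation block_mxEul block_mxEur block_mxEdl block_mxEdr !mxE /=.
by rewrite -[RHS](cos2Dsin2 t) ?(addn0, add0n); ring.
Qed.

End PlaneRotation.

Theorem mainTheorem2 (R : realType) (T : 'M[R]_4) (P : {vspace 'cV[R]_4})
    (a b c d : 'cV[R]_4) (alpha beta : R)
    (hT : is_rotation T P)
    (ha : a \in P) (hb : b \in P)
    (hc : c \in orthocomp P) (hd : d \in orthocomp P)
    (habcd : orthonormal_basis [:: a; b; c; d])
    (halpha : rotation_angle T P a b alpha)
    (hbeta : rotation_angle T (orthocomp P) c d beta) :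
  [/\ T *m a = cos alpha *: a + sin alpha *: b,
      T *m b = - sin alpha *: a + cos alpha *: b,
      T *m c = cos beta *: c + sin beta *: d &
      T *m d = - sin beta *: c + cos beta *: d] /\
  T = cos alpha *: (a *m a^T + b *m b^T)
      + sin alpha *: (b *m a^T - a *m b^T)
      + cos beta *: (c *m c^T + d *m d^T)
      + sin beta *: (d *m c^T - c *m d^T) /\
  T^T *m T = 1%:M /\ \det T = 1.
Proof.
have [_ rP rO] := hT.
have [_ on] := habcd.
have /and4P[/and4P[/eqP aa /eqP bb /eqP cc /eqP dd] /and3P[/eqP ab /eqP ac /eqP ad]
  /andP[/eqP bc /eqP bd] /eqP cd] : [&& [&& dot a a == 1, dot b b == 1,
    dot c c == 1 & dot d d == 1], [&& dot a b == 0, dot a c == 0 & dot a d == 0],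
    (dot b c == 0) && (dot b d == 0) & dot c d == 0].
  by move: on; rewrite /orthonormal /= !andbT.
have mx1 (x y : 'cV[R]_4) : x^T *m y = (dot x y)%:M by exact: mx11_scalar.
pose Q : 'M[R]_(4, (1 + 1) + (1 + 1)) := row_mx (row_mx a b) (row_mx c d).
have QtQ : Q^T *m Q = 1%:M.
  rewrite /Q !tr_row_mx !mul_col_row !mx1.
  rewrite (dotC b a) (dotC c a) (dotC d a) (dotC c b) (dotC d b) (dotC d c).
  rewrite aa bb cc dd ab ac ad bc bd cd.
  by rewrite raddf0 block_mx0 -!scalar_mx_block.
have QQt : Q *m Q^T = 1%:M by apply: mulmx1C.
(* Completeness relation of the basis: it yields both the coordinates of a vector and, multiplied by
   [T], the matrix formula. *)
have id4 : a *m a^T + b *m b^T + (c *m c^T + d *m d^T) = 1%:M.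
  by rewrite -QQt /Q !tr_row_mx !mul_row_col.
have expand x : x = dot a x *: a + dot b x *: b + (dot c x *: c + dot d x *: d).
  by rewrite -[LHS]mul1mx -id4 !mulmxDl !mul_col_dot.
have PO x y : x \in P -> y \in orthocomp P -> dot y x = 0.
  by move=> xP /mem_orthovP/(_ x xP).
have [Ta Tb] : T *m a = cos alpha *: a + sin alpha *: b /\
               T *m b = - sin alpha *: a + cos alpha *: b.
  apply: (rotation_angle_plane T P) => // x xP.
  by rewrite {1}[x]expand (PO x c) // (PO x d) // !scale0r !addr0.
have [Tc Td] : T *m c = cos beta *: c + sin beta *: d /\
               T *m d = - sin beta *: c + cos beta *: d.
  apply: (rotation_angle_plane T (orthocomp P)) => // x xO.
  rewrite {1}[x]expand (dotC a) (dotC b) (PO a x) // (PO b x) //.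
  by rewrite !scale0r !add0r.
split=> //; split.
  rewrite -[LHS]mulmx1 -id4 !mulmxDr !mulmxA Ta Tb Tc Td.
  by apply/matrixP => i j; rewrite !mxE !big_ord1 !mxE; ring.
pose D := block_mx (plane_rotation alpha) 0 0 (plane_rotation beta).
(* The four image formulas, read column by column. *)
have TQ : T *m Q = Q *m D.
  rewrite /Q /D !mul_mx_row !mul_row_block !mulmx0 addr0 add0r.
  by rewrite !mul_mx_scalar Ta Tb Tc Td.
have DtD : D^T *m D = 1%:M.
  rewrite /D tr_block_mx mulmx_block !trmx0 !mul0mx !mulmx0 !addr0 !add0r.
  by rewrite !plane_rotation_orthogonal -scalar_mx_block.
have TE : T = Q *m D *m Q^T by rewrite -TQ -mulmxA QQt mulmx1.
split.
  rewrite TE !trmx_mul trmxK !mulmxA -[_ *m Q^T *m Q]mulmxA QtQ mulmx1.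
  by rewrite -[_ *m D^T *m D]mulmxA DtD mulmx1.
(* The basis may have either orientation: only this product enters the determinant of [T]. *)
have detQ : \det Q^T * \det Q = 1 by rewrite -det_mulmx QtQ det1.
have detD : \det D = 1 by rewrite /D det_ublock !det_plane_rotation mulr1.
by rewrite TE !det_mulmx detD mulr1 mulrC.
Qed.
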